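(* The variety of upper semilattice-ordered pocrigs is arithmetical, i.e. congruence distributive and congruence permutable.
   Context: An upper semilattice-ordered pocrig is an algebra $(A,\vee,\cdot,\to,1)$ where $(A,\vee)$ is a join-semilattice with order $\le$, $\cdot$ is commutative and isotone ($x\le y$ implies $xz\le yz$), $1$ is a neutral element for $\cdot$ and the greatest element of $A$, and $x\le y\to z$ iff $xy\le z$ for all $x,y,z$. (This class is equationally definable.) *)

(* Defs.v *)
From Stdlib Require Export Relation_Definitions.

Set Implicit Arguments.
Unset Strict Implicit.

Record signature := Signature { symbol : Type; arity : symbol -> nat }.

(* Curried n-ary operations, so that a binary operation symbol is interpreted,
   up to conversion, by a function [A -> A -> A]. *)
Fixpoint nary (n : nat) (A : Type) : Type :=
  match n with
  | O => A
  | S m => A -> nary m A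
  end.

Record algebra (sg : signature) := Algebra {
  carrier :> Type;
  op : forall f : symbol sg, nary (arity f) carrier
}.

(* [related_nary R f g]: R x1 y1, ..., R xn yn imply
   R (f x1 ... xn) (g y1 ... yn). *)
Fixpoint related_nary (A : Type) (R : relation A) (n : nat) :
    nary n A -> nary n A -> Prop :=
  match n with
  | O => fun a b => R a b
  | S m => fun f g => forall x y : A, R x y -> related_nary R (f x) (g y)
  end.

Record congruence (sg : signature) (A : algebra sg) (R : relation A) : Prop := {
  congruence_equiv : equivalence A R;
  congruence_op : forall f : symbol sg, related_nary R (op A f) (op A f)
}.

Definition con_meet (A : Type) (R S : relation A) : relation A :=
  fun x y => R x y /\ S x y.

(* The least congruence containing R and S. *)
Definition con_join (sg : signature) (A : algebra sg) (R S : relation A) :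
    relation A :=
  fun x y => forall T : relation A, congruence T ->
    inclusion A R T -> inclusion A S T -> T x y.

Definition rel_comp (A : Type) (R S : relation A) : relation A :=
  fun x z => exists y : A, R x y /\ S y z.

Definition congruence_distributive (sg : signature) (A : algebra sg) : Prop :=
  forall R S T : relation A, congruence R -> congruence S -> congruence T ->
    same_relation A (con_meet R (con_join S T))
                    (con_join (con_meet R S) (con_meet R T)).

Definition congruence_permutable (sg : signature) (A : algebra sg) : Prop :=
  forall R S : relation A, congruence R -> congruence S ->
    same_relation A (rel_comp R S) (rel_comp S R).

(* A class (in particular a variety) of algebras has one of these properties
   when all of its members do. *)
Definition arithmetical (sg : signature) (K : algebra sg -> Prop) : Prop :=
  (forall A : algebra sg, K A -> congruence_distributive A) /\
  (forall A : algebra sg, K A -> congruence_permutable A).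

Inductive pocrig_symbol := Join | Mul | Imp | One.

Definition pocrig_sig : signature :=
  @Signature pocrig_symbol
    (fun f => match f with Join => 2 | Mul => 2 | Imp => 2 | One => 0 end).

Section PocrigOperations.
Variable A : algebra pocrig_sig.
Definition join : A -> A -> A := @op pocrig_sig A Join.
Definition mul : A -> A -> A := @op pocrig_sig A Mul.
Definition imp : A -> A -> A := @op pocrig_sig A Imp.
Definition one : A := @op pocrig_sig A One.
Definition le (x y : A) : Prop := join x y = y.
End PocrigOperations.

(* The multiplication is only a groupoid operation: associativity is not
   required. *)
Record upper_semilattice_pocrig (A : algebra pocrig_sig) : Prop := {
  join_assoc : forall x y z : A, join x (join y z) = join (join x y) z;
  join_comm : forall x y : A, join x y = join y x;
  join_idem : forall x : A, join x x = x;
  mul_comm : forall x y : A, mul x y = mul y x;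
  mul_isotone : forall x y z : A, le x y -> le (mul x z) (mul y z);
  mul_one : forall x : A, mul x (one A) = x;
  le_one : forall x : A, le x (one A);
  residuation : forall x y z : A, le x (imp y z) <-> le (mul x y) z
}.

(* Main.v *)
(** Arithmeticity follows from a Pixley term: p(x,x,z) = z, p(x,z,z) = x and
    p(x,y,x) = x. Writing d(x,z) = x(x -> z), we have d(x,z) <= x, d(x,z) <= z
    and d(x,x) = x, so
      p(x,y,z) = ((y -> z)x \/ (y -> x)z) \/ d(x,z)
    is such a term; the first two joinands alone form a Mal'cev term. *)

From Stdlib Require Import Setoid.
Require Import Defs.

Section CongruenceComposition.
Variables (sg : signature) (A : algebra sg).

Lemma related_nary_comp (R S : relation A) n (f g h : nary n A) :
  related_nary R f g -> related_nary S g h -> related_nary (rel_comp R S) f h.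
Proof.
  induction n as [|n IH]; simpl; intros Hfg Hgh.
  - now exists g.
  - intros x z (y & Hxy & Hyz). exact (IH _ _ _ (Hfg _ _ Hxy) (Hgh _ _ Hyz)).
Qed.

(** For transitivity, [H] swaps the two inner factors of [R;S;R;S], and equal neighbours then merge.
    For symmetry, reversing a path gives [S;R], which [H] turns back. *)
Lemma rel_comp_congruence (R S : relation A) :
  congruence R -> congruence S ->
  inclusion A (rel_comp S R) (rel_comp R S) -> congruence (rel_comp R S).
Proof.
  intros [[rR tR sR] oR] [[rS tS sS] oS] H. split; [split|].
  - intros x. now exists x.
  - intros x y z (u & Hxu & Huy) (v & Hyv & Hvz).
    destruct (H u v) as (w & Huw & Hwv); [now exists y|].
    exists w. split; eauto.
  - intros x y (u & Hxu & Huy). apply H. exists u. auto.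
  - intros f. eapply related_nary_comp; auto.
Qed.

Lemma con_join_comp (R S : relation A) :
  congruence R -> congruence S ->
  inclusion A (rel_comp S R) (rel_comp R S) ->
  inclusion A (con_join R S) (rel_comp R S).
Proof.
  intros cR cS H x y Hxy. apply Hxy.
  - now apply rel_comp_congruence.
  - intros u v Huv. exists v. split; [exact Huv|apply cS].
  - intros u v Huv. exists u. split; [apply cR|exact Huv].
Qed.

End CongruenceComposition.

Section Pixley.
Variables (sg : signature) (A : algebra sg) (p : A -> A -> A -> A).
(** Preservation of all congruences is the only property of term operations used below, so it stands
    in for a syntax of terms. *)
Hypothesis p_compatible : forall R : relation A, congruence R ->
  forall x x' y y' z z', R x x' -> R y y' -> R z z' -> R (p x y z) (p x' y' z').
Hypothesis p_left : forall x z, p x x z = z.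
Hypothesis p_right : forall x z, p x z z = x.

Lemma malcev_rel_comp (R S : relation A) :
  congruence R -> congruence S ->
  inclusion A (rel_comp R S) (rel_comp S R).
Proof.
  intros cR cS x z (y & Hxy & Hyz).
  destruct (congruence_equiv cR) as [rR tR sR].
  destruct (congruence_equiv cS) as [rS tS sS].
  (* As [S y z] and [R x y]: [x = p x y y] is [S]-related to [p x y z], which is [R]-related to
     [p y y z = z]. *)
  exists (p x y z). split.
  - rewrite <- (p_right x y) at 1. now apply p_compatible.
  - rewrite <- (p_left y z) at 2. now apply p_compatible.
Qed.

Lemma malcev_congruence_permutable : congruence_permutable A.
Proof. intros R S cR cS. split; now apply malcev_rel_comp. Qed.

Hypothesis p_middle : forall x y, p x y x = x.

(** Permutability reduces the join to a path from [x] via [S] to [w] and via [T] to [y]. Replacing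
    [w] by [p x w y] keeps a path, now with [T] first, and [p x w x = x] together with [R x y] puts
    the new midpoint in the [R]-class of [x]. *)
Lemma pixley_congruence_distributive : congruence_distributive A.
Proof.
  intros R S T cR cS cT. split.
  - intros x y [Rxy Jxy].
    destruct (congruence_equiv cR) as [rR tR sR].
    destruct (congruence_equiv cS) as [rS tS sS].
    destruct (congruence_equiv cT) as [rT tT sT].
    apply con_join_comp in Jxy; [|assumption..|now apply malcev_rel_comp].
    destruct Jxy as (w & Sxw & Twy).
    assert (Rx : R x (p x w y)).
    { rewrite <- (p_middle x w) at 1. now apply p_compatible. }
    assert (Tx : T x (p x w y)).
    { rewrite <- (p_right x y) at 1. apply p_compatible; auto. }
    assert (Sy : S (p x w y) y).
    { rewrite <- (p_left x y) at 2. apply p_compatible; auto. }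
    intros U cU HS HT.
    destruct (congruence_equiv cU) as [_ tU _].
    apply tU with (p x w y).
    + now apply HT.
    + apply HS. split; [|exact Sy]. eauto.
  (* This inclusion holds in every algebra. *)
  - intros x y H. split.
    + apply H; [exact cR|now intros u v []..].
    + intros U cU HS HT. apply H; [exact cU| |]; intros u v []; auto.
Qed.

End Pixley.

Section Pocrig.
Variable A : algebra pocrig_sig.

Definition pocrig_pixley (x y z : A) : A :=
  join (join (mul (imp y z) x) (mul (imp y x) z)) (mul x (imp x z)).

Lemma pocrig_pixley_compatible (R : relation A) : congruence R ->
  forall x x' y y' z z', R x x' -> R y y' -> R z z' ->
  R (pocrig_pixley x y z) (pocrig_pixley x' y' z').
Proof.
  intros [_ oR] x x' y y' z z' Hx Hy Hz.
  (* The ascriptions unfold [related_nary] by conversion into a form that [auto] can apply. *)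
  pose proof (oR Join : forall a b, R a b -> forall c d, R c d ->
    R (join a c) (join b d)) as HJ.
  pose proof (oR Mul : forall a b, R a b -> forall c d, R c d ->
    R (mul a c) (mul b d)) as HM.
  pose proof (oR Imp : forall a b, R a b -> forall c d, R c d ->
    R (imp a c) (imp b d)) as HI.
  unfold pocrig_pixley. auto 10.
Qed.

Hypothesis HA : upper_semilattice_pocrig A.

Lemma one_mul (x : A) : mul (one A) x = x.
Proof. rewrite (mul_comm HA). apply (mul_one HA). Qed.

Lemma mul_le_right (x y : A) : le (mul x y) y.
Proof.
  pose proof (mul_isotone HA y (le_one HA x)) as H. now rewrite one_mul in H.
Qed.

Lemma imp_mul_le (x y : A) : le (mul (imp x y) x) y.
Proof. apply (residuation HA), (join_idem HA). Qed.

Lemma imp_diag (x : A) : imp x x = one A.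
Proof.
  assert (H : le (one A) (imp x x)).
  { apply (residuation HA). rewrite one_mul. apply (join_idem HA). }
  (* Antisymmetry: [le a b] is an equation, so [H] can be rewritten with. *)
  rewrite <- H, (join_comm HA). apply (le_one HA).
Qed.

Lemma join_le_r (x y : A) : le y x -> join x y = x.
Proof. intros H. now rewrite (join_comm HA). Qed.

Lemma pocrig_pixley_left (x z : A) : pocrig_pixley x x z = z.
Proof.
  unfold pocrig_pixley.
  rewrite imp_diag, one_mul, (mul_comm HA x), (imp_mul_le x z).
  apply join_le_r, imp_mul_le.
Qed.

(** The first joinand is [x]; it absorbs [(z -> x)z] by residuation and [(x -> z)x] by
    integrality. *)
Lemma pocrig_pixley_right (x z : A) : pocrig_pixley x z z = x.
Proof.
  unfold pocrig_pixley.
  rewrite imp_diag, one_mul, (mul_comm HA x), (join_le_r _ _ (imp_mul_le z x)).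
  apply join_le_r, mul_le_right.
Qed.

(** The first two joinands both become [(y -> x)x], which is only below [x]; the third one is [x]
    itself. *)
Lemma pocrig_pixley_middle (x y : A) : pocrig_pixley x y x = x.
Proof.
  unfold pocrig_pixley.
  rewrite imp_diag, (mul_one HA), (join_idem HA). apply mul_le_right.
Qed.

End Pocrig.

Theorem theorem5p6 : arithmetical upper_semilattice_pocrig.
Proof.
  split; intros A HA.
  - apply (pixley_congruence_distributive _ _ _ (pocrig_pixley_compatible A)).
    + exact (pocrig_pixley_left A HA).
    + exact (pocrig_pixley_right A HA).
    + exact (pocrig_pixley_middle A HA).
  - apply (malcev_congruence_permutable _ _ _ (pocrig_pixley_compatible A)).
    + exact (pocrig_pixley_left A HA).
    + exact (pocrig_pixley_right A HA).
Qed.
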